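(* Let $M\in\mathbb{C}^{n\times n}$ satisfy $\mathrm{Ind}(M)\le 1$ and let $r=\mathrm{rk}(M)$. Let $L\in\mathbb{C}^{n\times(n-r)}$ with $\mathrm{rk}(L)=n-r$ and $\mathcal{R}(L)=\mathcal{N}(M^\ast)$. Then the entries of the core inverse $M^{\mathrm{core}}$ are given by $$M^{\mathrm{core}}_{i,j}=\frac{\det\left(\left(MM^\ast M+LL^\ast\right)\left(i\to (MM^\ast)e_j\right)\right)}{\det\left(MM^\ast M+LL^\ast\right)},\qquad 1\le i,j\le n$$ (in particular, the determinant in the denominator is nonzero).
   Context: $\mathcal{R}(\cdot)$ and $\mathcal{N}(\cdot)$ denote range (column space) and null space, and $^\ast$ the conjugate transpose. $e_j$ is the $j$-th column of the identity matrix $I_n$, and $M^{\mathrm{core}}_{i,j}=e_i^TM^{\mathrm{core}}e_j$ is the $(i,j)$ entry. For a matrix $A$ and a column vector $c$ of matching length, $A(i\to c)$ denotes the matrix obtained from $A$ by replacing its $i$-th column by $c$. The index $\mathrm{Ind}(M)$ of a singular $M\in\mathbb{C}^{n\times n}$ is the smallest positive integer $k$ with $\mathrm{rk}(M^{k+1})=\mathrm{rk}(M^k)$; the index of a nonsingular matrix is $0$. For $M\in\mathbb{C}^{n\times n}$ with $\mathrm{Ind}(M)\le 1$, the core inverse $M^{\mathrm{core}}$ is the unique matrix $X\in\mathbb{C}^{n\times n}$ satisfying $MXM=M$, $MX^2=X$ and $(MX)^\ast=MX$. *)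

(* Defs.v *)
From mathcomp Require Import all_boot all_order all_algebra.
From mathcomp Require Import spectral.
From mathcomp Require Import boolp classical_sets reals.
From mathcomp.real_closed Require Export complex.

Set Implicit Arguments.
Unset Strict Implicit.
Unset Printing Implicit Defensive.

Import Order.TTheory GRing.Theory Num.Theory.
Local Open Scope ring_scope.
Local Open Scope sesquilinear_scope.

(* MathComp's submodule theory [(_ <= _)%MS] and [kermx] are about row spaces;
   range and null space here are sets of column vectors. *)
Definition range_mx (F : fieldType) m n (A : 'M[F]_(m, n)) : set 'cV[F]_m :=
  [set x | exists y : 'cV[F]_n, x = A *m y]%classic.

Definition null_mx (F : fieldType) m n (A : 'M[F]_(m, n)) : set 'cV[F]_n :=
  [set x | A *m x = 0]%classic.

Definition replace_col (F : fieldType) m n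
    (A : 'M[F]_(m, n)) (i : 'I_n) (c : 'cV[F]_m) : 'M[F]_(m, n) :=
  \matrix_(k, l) if l == i then c k 0 else A k l.

Section Index.
Variables (F : fieldType) (n : nat).
Implicit Types M : 'M[F]_n.

Lemma index_ex M :
  exists k, (0 < k)%N && (\rank (M ^+ k.+1) == \rank (M ^+ k)).
Proof.
apply: contrapT => nE.
have rk_lt k : (\rank (M ^+ k.+2) < \rank (M ^+ k.+1))%N.
  have le : (\rank (M ^+ k.+2) <= \rank (M ^+ k.+1))%N.
    by rewrite exprS; apply: mxrankM_maxr.
  rewrite ltn_neqAle le andbT; apply/negP => eq; apply: nE.
  by exists k.+1; rewrite ltn0Sn.
have bnd k : (\rank (M ^+ k.+1) + k <= n)%N.
  elim: k => [|k IH]; first by rewrite addn0 rank_leq_row.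
  by rewrite addnS -addSn; apply: leq_trans IH; rewrite leq_add2r.
by have := leq_trans (leq_addl _ _) (bnd n.+1); rewrite ltnn.
Qed.

Definition index_mx M : nat :=
  if M \in unitmx then 0%N else ex_minn (index_ex M).

Lemma mxrank_sqr_factor M :
  (\rank M <= \rank (M *m M))%N -> exists W, M = W *m (M *m M).
Proof.
move=> rk2; apply/submxP; have [_] := mxrank_leqif_sup (submxMl M M).
by rewrite eqn_leq rk2 mxrankM_maxl => <-.
Qed.

Lemma index_mx_le1 M :
  (index_mx M <= 1)%N -> exists W, M = W *m (M *m M).
Proof.
move=> ind1; apply: mxrank_sqr_factor.
move: ind1; rewrite /index_mx; case: ifP => [Mu _|_].
  by rewrite !mxrank_unit // unitmx_mul Mu.
case: ex_minnP => -[|[|k]] //= /eqP rk _ _.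
by rewrite -[M in leqLHS]expr1 -rk expr2.
Qed.

End Index.

Section CoreInverse.
Variables (C : numClosedFieldType) (n : nat).
Implicit Types M X : 'M[C]_n.

Definition is_core_inverse M X : Prop :=
  [/\ M *m X *m M = M, M *m (X *m X) = X & (M *m X) ^t* = M *m X].

(* [is_core_inverse_ex] and [is_core_inverse_uniq] below show that this is
   well defined when the index of M is at most 1; 0 is a junk value taken
   only for larger index. *)
Definition core_inverse M : 'M[C]_n :=
  xget 0 [set X | is_core_inverse M X]%classic.

Lemma adjmxM m p q (A : 'M[C]_(m, p)) (B : 'M[C]_(p, q)) :
  (A *m B) ^t* = B ^t* *m A ^t*.
Proof. by rewrite trmx_mul map_mxM. Qed.

Lemma adjmx_mul_eq0 m p (A : 'M[C]_(m, p)) : A *m A ^t* = 0 -> A = 0.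
Proof.
move=> A0; apply/matrixP => i j; rewrite mxE.
have /matrixP/(_ i i) := A0; rewrite !mxE => /psumr_eq0P s0.
have /s0/(_ j isT)/eqP : forall k : 'I_p, true -> 0 <= A i k * A ^t* k i.
  by move=> k _; rewrite !mxE mul_conjC_ge0.
by rewrite !mxE mul_conjC_eq0 => /eqP.
Qed.

Lemma gram_unit m p (A : 'M[C]_(m, p)) : \rank A = p -> A ^t* *m A \in unitmx.
Proof.
move=> rA; have fA : row_free (A ^t*).
  by rewrite /row_free mxrank_map mxrank_tr rA.
rewrite -row_free_unit -kermx_eq0; apply/eqP.
apply: (row_free_inj fA); rewrite mul0mx.
apply: adjmx_mul_eq0; rewrite adjmxM trmxCK mulmxA -(mulmxA (kermx _)).
by rewrite mulmx_ker mul0mx.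
Qed.

Lemma is_core_inverse_ex M :
  (index_mx M <= 1)%N -> exists X, is_core_inverse M X.
Proof.
move=> /index_mx_le1 [W MW].
have [r [F [G [FG rF rM]]]] : exists r (F : 'M_(n, r)) (G : 'M_(r, n)),
    [/\ F *m G = M, \rank F = r & (r <= \rank M)%N].
  exists (\rank M), (col_base M), (row_base M); split=> //.
    exact: mulmx_base.
  by apply/eqP; apply: col_base_full.
have GFu : G *m F \in unitmx.
  rewrite -row_free_unit /row_free eqn_leq rank_leq_row /=.
  apply: leq_trans rM _.
  have {1}-> : M = W *m (F *m (G *m F) *m G).
    by rewrite -!mulmxA FG (mulmxA F) FG.
  apply: leq_trans (mxrankM_maxr _ _) _.
  by apply: leq_trans (mxrankM_maxl _ _) _; apply: mxrankM_maxr.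
have FFu : F ^t* *m F \in unitmx.
  by apply: gram_unit.
pose N := invmx (F ^t* *m F).
have Nh : N ^t* = N.
  by rewrite /N trmx_inv map_invmx adjmxM trmxCK.
pose X := F *m invmx (G *m F) *m N *m F ^t*.
have MX : M *m X = F *m N *m F ^t*.
  by rewrite -FG /X !mulmxA -(mulmxA F G F) mulmxK.
exists X; split.
- by rewrite MX -FG !mulmxA -(mulmxA (F *m N)) mulmxKV.
- by rewrite mulmxA MX /X !mulmxA -(mulmxA (F *m N)) mulmxKV.
- by rewrite MX !adjmxM trmxCK Nh mulmxA.
Qed.

Lemma is_core_inverse_uniq M X Y :
  is_core_inverse M X -> is_core_inverse M Y -> X = Y.
Proof.
have half A B : is_core_inverse M A -> is_core_inverse M B ->
    M *m A = M *m B.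
  move=> [A1 _ A3] [B1 _ B3].
  by rewrite -{1}B1 -(mulmxA (M *m B)) -A3 -{1}B3 -adjmxM mulmxA A1 B3.
move=> cX cY; have MXY := half _ _ cX cY.
case: cX cY => [X1 X2 _] [_ Y2 _].
have [|W MW] := @mxrank_sqr_factor _ _ M.
  have MMXXM : M *m M *m (X *m X *m M) = M.
    by rewrite -[RHS]X1 -{3}X2 !mulmxA.
  by rewrite -{1}MMXXM mxrankM_maxl.
apply/eqP; rewrite -subr_eq0 -X2 -Y2 -mulmxBr {1}MW -!mulmxA mulmxBr X2 Y2.
by rewrite mulmxBr MXY subrr mulmx0.
Qed.

Lemma core_inverseP M :
  (index_mx M <= 1)%N -> is_core_inverse M (core_inverse M).
Proof. by move=> /is_core_inverse_ex; apply: xgetPex. Qed.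

End CoreInverse.

(* Main.v *)
Require Import Defs.
From mathcomp Require Import all_boot all_order all_algebra.
From mathcomp Require Import spectral classical_sets reals.

Set Implicit Arguments.
Unset Strict Implicit.
Unset Printing Implicit Defensive.

Import Order.TTheory GRing.Theory Num.Theory.
Local Open Scope ring_scope.
Local Open Scope sesquilinear_scope.

(** Write [X] for the core inverse of [M] and [D] for [M M^* M + L L^*].  The
    formula is Cramer's rule for the linear system [D X = M M^*], read one
    column at a time.

    The system holds because [M X] is the Hermitian projector onto the range of
    [M]: conjugating [M X M = M] gives [M^* M X = M^*], and the term [L L^* X]
    vanishes since [X = M X^2] has its columns in the range of [M], which is
    orthogonal to the range of [L] ([normal_eq_core_inverse]).

    The matrix [D] is nonsingular because its two summands have orthogonal
    ranges, so that [D v = 0] forces [M v = 0] and [L^* v = 0].  The second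
    equation says that [v] is orthogonal to the null space of [M^*], that is,
    [v = M X v]; as [M] has index at most one, its range meets its null space
    trivially, and [v = 0] ([normal_matrix_inj]). *)

(** Laplace expansion along column [i] only involves cofactors of [A] that
    ignore that column, hence survive its replacement. *)
Lemma det_replace_col (F : fieldType) n (A : 'M[F]_n) i (c : 'cV[F]_n) :
  \det (replace_col A i c) = (\adj A *m c) i 0.
Proof.
rewrite (expand_det_col _ i) mxE; apply: eq_bigr => k _.
rewrite !mxE eqxx mulrC; congr (_ * _).
rewrite /cofactor; congr (_ * \det _).
by apply/matrixP => p q; rewrite !mxE eq_sym (negPf (neq_lift _ _)).
Qed.

Lemma cramer_rule (F : fieldType) n (A : 'M[F]_n) (x : 'cV[F]_n) i :
  \det A != 0 -> x i 0 = \det (replace_col A i (A *m x)) / \det A.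
Proof.
move=> A0; rewrite det_replace_col mulmxA mul_adj_mx mul_scalar_mx mxE.
by rewrite mulrC mulKf.
Qed.

Lemma det_neq0_inj (F : fieldType) n (A : 'M[F]_n) :
  (forall v : 'cV[F]_n, A *m v = 0 -> v = 0) -> \det A != 0.
Proof.
move=> Ainj; rewrite -det_tr; apply/negP => /det0P [v v0 vA].
move: v0; rewrite -trmx_eq0 (Ainj v^T) ?eqxx //.
by rewrite -[A]trmxK -trmx_mul vA trmx0.
Qed.

Section NormalEquations.
Variable C : numClosedFieldType.

(** The hypothesis gives [(A v)^* (A v) = 0], whose diagonal entries are the
    sums of squared moduli of the columns of [A v]. *)
Lemma gram_mul_eq0 m n p (A : 'M[C]_(m, n)) (v : 'M[C]_(n, p)) :
  A ^t* *m A *m v = 0 -> A *m v = 0.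
Proof.
move=> Av; rewrite -[LHS]trmxCK (_ : (A *m v) ^t* = 0) ?trmx0 ?map_mx0 //.
apply: adjmx_mul_eq0; rewrite trmxCK adjmxM -!mulmxA.
by rewrite [A ^t* *m _]mulmxA Av mulmx0.
Qed.

Lemma range_sub_null_mul0 m n p (A : 'M[C]_(m, n)) (L : 'M[C]_(n, p)) :
  (range_mx L `<=` null_mx A)%classic -> A *m L = 0.
Proof.
move=> sLA; apply/matrixP => i j.
have /sLA : range_mx L (col j L) by exists (delta_mx j 0); rewrite colE.
rewrite /null_mx /= colE mulmxA -colE => /matrixP/(_ i 0).
by rewrite !mxE.
Qed.

Variables (n p : nat) (M X : 'M[C]_n) (L : 'M[C]_(n, p)).
Hypothesis coreX : is_core_inverse M X.

(** The adjoint of [M X M = M], as [M X] is Hermitian. *)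
Lemma adj_mul_core_inverse : M ^t* *m (M *m X) = M ^t*.
Proof. by case: coreX => MXM _ <-; rewrite -adjmxM MXM. Qed.

Lemma normal_eq_core_inverse :
  M ^t* *m L = 0 ->
  (M *m M ^t* *m M + L *m L ^t*) *m X = M *m M ^t*.
Proof.
move=> ML; have LM : L ^t* *m M = 0.
  by rewrite -[M]trmxCK -adjmxM ML trmx0 map_mx0.
have LX : L ^t* *m X = 0.
  by case: coreX => _ <- _; rewrite mulmxA LM mul0mx.
by rewrite mulmxDl -!mulmxA LX mulmx0 addr0 adj_mul_core_inverse.
Qed.

Lemma normal_matrix_inj (v : 'cV[C]_n) :
  (index_mx M <= 1)%N -> range_mx L = null_mx (M ^t*) ->
  (M *m M ^t* *m M + L *m L ^t*) *m v = 0 -> v = 0.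
Proof.
move=> /index_mx_le1 [W MW] RL Dv.
have ML : M ^t* *m L = 0 by apply: range_sub_null_mul0; rewrite RL.
have LM : L ^t* *m M = 0 by rewrite -[M]trmxCK -adjmxM ML trmx0 map_mx0.
(* Multiplying by [M^*] kills the second summand and leaves
   [(M^* M)^* (M^* M) v = 0]. *)
have Mv : M *m v = 0.
  apply: gram_mul_eq0; apply: gram_mul_eq0.
  have := congr1 (mulmx (M ^t*)) Dv.
  rewrite mulmx0 mulmxDl mulmxDr !mulmxA ML !mul0mx addr0.
  by rewrite adjmxM trmxCK.
have Lv : L ^t* *m v = 0.
  apply: gram_mul_eq0; rewrite trmxCK; move: Dv.
  by rewrite mulmxDl -!mulmxA Mv !mulmx0 add0r.
(* The residual [v - M X v] lies in the null space of [M^*], hence is some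
   [L z]; it is also orthogonal to the columns of [L]. *)
have [z vz] : range_mx L (v - M *m X *m v).
  by rewrite RL /null_mx /= mulmxBr mulmxA adj_mul_core_inverse subrr.
have Lz : L *m z = 0.
  apply: gram_mul_eq0; rewrite -mulmxA -vz mulmxBr Lv.
  by rewrite !mulmxA LM !mul0mx subrr.
have vE : v = M *m X *m v by apply/eqP; rewrite -subr_eq0 vz Lz.
by rewrite vE MW -!mulmxA [M *m (X *m v)]mulmxA -vE Mv mulmx0.
Qed.

End NormalEquations.

Theorem theorem3p7 (R : realType) (n r : nat) (M : 'M[R[i]]_n)
    (hM : (index_mx M <= 1)%N) (hr : \rank M = r)
    (L : 'M[R[i]]_(n, n - r)) (hL : \rank L = (n - r)%N)
    (hRL : range_mx L = null_mx (M ^t*)) :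
  let D := M *m M ^t* *m M + L *m L ^t* in
  \det D != 0 /\
  forall i j : 'I_n,
    core_inverse M i j =
      \det (replace_col D i (M *m M ^t* *m col j 1%:M)) / \det D.
Proof.
move=> D; have coreX := @core_inverseP _ _ M hM.
have D0 : \det D != 0.
  by apply: det_neq0_inj => v; apply: normal_matrix_inj coreX _ hM hRL.
split=> // i j.
have DX : D *m core_inverse M = M *m M ^t*.
  by apply: normal_eq_core_inverse coreX _; apply: range_sub_null_mul0; rewrite hRL.
have := @cramer_rule _ _ D (col j (core_inverse M)) i D0.
by rewrite !colE mul1mx mulmxA DX -colE mxE.
Qed.
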